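(* Let $p_\theta$ be the ContinuouSP conditional probability density, viewed as the map $(A,X,L)\mapsto p_\theta(X,L\mid A)$ on $\bigcup_{n\ge1}\mathcal P_n$. For every positive integer $n$, $p_\theta$ is $n$-weakly re-description invariant. Moreover, the induced map $p_\theta\circ\mathrm{PtoS}|_{\mathcal P_n}^{-1}:\mathrm{PtoS}(\mathcal P_n)\to\mathbb R$ is translation invariant, rotation invariant, and continuous (in the sense of continuity on solid materials).
   Context: **Solid materials.** Let $\mathbb A$ be the (finite) set of atomic species. $\mathcal S$ is the set of all countable subsets of $\mathbb A\times\mathbb R^{3\times1}$; its elements are called solid materials. Let $f:\mathcal S\rightharpoonup\mathcal Y$ be a partial map into a set $\mathcal Y$. - $f$ is translation invariant if for all $S\in\mathrm{Dom}(f)$ and $b\in\mathbb R^{3\times 1}$, $f(\{(a,x+b)\mid(a,x)\in S\})=f(S)$. - $f$ is rotation invariant if for all $S\in\mathrm{Dom}(f)$ and $Q\in\mathrm O(3)$, $f(\{(a,Qx)\mid(a,x)\in S\})=f(S)$. - If $\mathcal Y=\mathbb R^m$, $f$ is continuous at $S$ if for every $\varepsilon>0$ there is $\delta>0$ such that for every $S'\in\mathrm{Dom}(f)$: if there is a bijection $\phi:S\to S'$ such that, writing $\phi(a,x)=(a',x')$, one has $a'=a$ and $\|x'-x\|<\delta$ for all $(a,x)\in S$, then $\|f(S')-f(S)\|<\varepsilon$. $f$ is continuous if it is continuous at every $S\in\mathrm{Dom}(f)$. **Periodic units.** $\mathcal P_n$ is the set of $(A,X,L)$ with $A=(a_1,\dots,a_n)\in\mathbb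 A^n$ (species vector), $X=(x_1,\dots,x_n)\in\mathbb R^{3\times n}$ (coordinate matrix), $L\in\mathbb R^{3\times3}$ invertible (lattice basis), such that $x_j+Lk\neq x_i$ for all $i,j\in\{1,\dots,n\}$, $k\in\mathbb Z^{3\times1}$ with $i\ne j$ or $k\neq0$. Define $\mathrm{PtoS}:\bigcup_{n\ge1}\mathcal P_n\to\mathcal S$ by $\mathrm{PtoS}(A,X,L)=\{(a_i,x_i+Lk)\mid i\in\{1,\dots,n\},\,k\in\mathbb Z^{3\times1}\}$. A map $g:\bigcup_{n\ge1}\mathcal P_n\to\mathcal Y$ is $n$-weakly re-description invariant if for all $P,P'\in\mathcal P_n$, $\mathrm{PtoS}(P')=\mathrm{PtoS}(P)$ implies $g(P')=g(P)$; then $g\circ\mathrm{PtoS}|_{\mathcal P_n}^{-1}$ denotes the unique map $f:\mathrm{PtoS}(\mathcal P_n)\to\mathcal Y$ with $f\circ\mathrm{PtoS}|_{\mathcal P_n}=g|_{\mathcal P_n}$, regarded as a partial map on $\mathcal S$. **The energy function.** Fix the parameters $\theta$, a cutoff distance $D>0$, and dimensions $d_{\mathrm v},d_{\mathrm e}$. For $P=(A,X,L)\in\mathcal P_n$ and $i\in\{1,\dots,n\}$ put $\mathrm N_P(i)=\{(j,k)\mid j\in\{1,\dots,n\},\,k\in\mathbb Z^{3\times1},\,\|x_j+Lk-x_i\|<D\}$. For $(j,k)\in\mathrm N_P(i)$ let $e_{i,j,k}\in\mathbb R^{d_{\mathrm e}}$ be an edge feature that is a fixed continuous function of the distance $\|x_j+Lk-x_i\|$.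 Each node $i$ has a feature $v_i\in\mathbb R^{d_{\mathrm v}}$ initialized as a fixed function of the species $a_i$. A fixed number of times, all node features are simultaneously updated by $$v_i\leftarrow v_i+\sum_{(j,k)\in\mathrm N_P(i)}\cos^2\!\left(\frac{\pi\|x_j+Lk-x_i\|}{2D}\right)\psi_\theta(v_i,v_j,e_{i,j,k}),$$ where $\psi_\theta:\mathbb R^{d_{\mathrm v}}\times\mathbb R^{d_{\mathrm v}}\times\mathbb R^{d_{\mathrm e}}\to\mathbb R^{d_{\mathrm v}}$ is continuous. Then $H_\theta(P)=\mathrm{CGCNN}_\theta'(P)\in\mathbb R$ is the value of a fixed multi-layer perceptron (a continuous map $\mathbb R^{d_{\mathrm v}}\to\mathbb R$) at the mean $\frac1n\sum_{i=1}^n v_i$ of the final node features. **The density.** Fix an inverse temperature $\beta>0$. For $(A,X,L)\in\mathcal P_n$, $$p_\theta(X,L\mid A)=\frac{\exp(-\beta H_\theta(A,X,L))}{Z(\theta,\beta,A)},\qquad Z(\theta,\beta,A)=\int_{X\in\mathbb R^{3\times n},\,L\in\mathbb R^{3\times3}}\exp(-\beta H_\theta(A,X,L))\,\mathrm dX\,\mathrm dL .$$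
   Formalization: The integral Z(θ,β,A) is always +∞ (H is constant on an infinite-measure low-density region), so p_θ is ill-defined; the formal theorem replaces Z by any real-valued convention agreeing with Z when finite, and integrates only over (X,L) forming periodic units. *)

(* Defs.v *)
From HB Require Import structures.
From mathcomp Require Import all_boot all_order all_algebra.
From mathcomp Require Import all_classical all_reals all_analysis.

Set Implicit Arguments.
Unset Strict Implicit.
Unset Printing Implicit Defensive.

Import Order.TTheory GRing.Theory Num.Theory.
Import numFieldNormedType.Exports.

Local Open Scope classical_set_scope.
Local Open Scope ring_scope.

(* The library norm on matrices is the max norm, hence this definition. *)
Definition enorm (R : realType) (x : 'cV[R]_3) : R :=
  Num.sqrt (\sum_(i < 3) x i 0 ^+ 2).

Section solid_materials.
Variables (R : realType) (species : finType).

Record material := Material {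
  atoms :> set (species * 'cV[R]_3);
  atoms_countable : countable atoms
}.

Lemma material_eq (S S' : material) : atoms S = atoms S' -> S = S'.
Proof.
case: S S' => [S cS] [S' cS'] /= SS'; subst S'.
by rewrite (Prop_irrelevance cS cS').
Qed.

Definition map_position (h : 'cV[R]_3 -> 'cV[R]_3) (s : species * 'cV[R]_3) :=
  (s.1, h s.2).

Definition map_material (h : 'cV[R]_3 -> 'cV[R]_3) (S : material) : material :=
  Material (sub_countable (card_image_le (map_position h) S)
                          (atoms_countable S)).

Definition translate (b : 'cV[R]_3) := map_material (fun x => x + b).
Definition rotate (Q : 'M[R]_3) := map_material (fun x => Q *m x).

Section partial_maps.
Variable Y : Type.

(* A partial map; it is undefined where its value is [None]. *)
Definition partial_map := material -> option Y.

Definition Dom (f : partial_map) : set material := [set S | exists y, f S = Some y].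

(* Equality in [option Y]: for S in the domain, the moved material is in the
   domain as well and has the same value. *)
Definition translation_invariant (f : partial_map) :=
  forall S, Dom f S -> forall b, f (translate b S) = f S.

Definition rotation_invariant (f : partial_map) :=
  forall S, Dom f S -> forall Q : 'M[R]_3, Q^T *m Q = 1%:M ->
    f (rotate Q S) = f S.

End partial_maps.

Section continuity.
Variable Y : normedModType R.

Definition close_materials (delta : R) (S S' : material) :=
  exists2 phi : species * 'cV[R]_3 -> species * 'cV[R]_3,
    set_bij S S' phi &
    forall s, atoms S s -> (phi s).1 = s.1 /\ enorm ((phi s).2 - s.2) < delta.

Definition material_continuous_at (f : partial_map Y) (S : material) :=
  forall y, f S = Some y ->
  forall eps : R, 0 < eps -> exists2 delta : R, 0 < delta &
    forall S' y', f S' = Some y' -> close_materials delta S S' ->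
      `|y' - y| < eps.

Definition material_continuous (f : partial_map Y) :=
  forall S, Dom f S -> material_continuous_at f S.

End continuity.

(* Triples (A, X, L) without the conditions that define a periodic unit. *)
Record description n := Description {
  species_vector : n.-tuple species;
  coordinates : 'M[R]_(3, n);
  lattice : 'M[R]_3
}.

(* x_j + L k *)
Definition site n (P : description n) (j : 'I_n) (k : 'cV[int]_3) : 'cV[R]_3 :=
  col j (coordinates P) + lattice P *m map_mx intr k.

Definition periodic_unit n : set (description n) := [set P |
  lattice P \in unitmx /\
  forall (i j : 'I_n) (k : 'cV[int]_3), i <> j \/ k <> 0 ->
    site P j k <> col i (coordinates P)].

Definition PtoS_set n (P : description n) : set (species * 'cV[R]_3) :=
  [set (tnth (species_vector P) ik.1, site P ik.1 ik.2)
     | ik in [set: 'I_n * 'cV[int]_3]].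

Lemma PtoS_countable n (P : description n) : countable (PtoS_set P).
Proof.
apply: sub_countable; first exact: card_image_le.
exact: countableP.
Qed.

Definition PtoS n (P : description n) : material := Material (PtoS_countable P).

(* A map g on the union of the P_n is a family indexed by n; only its values
   on periodic units are ever used. *)
Section redescription.
Variables (Y : Type) (n : nat) (g : forall m, description m -> Y).

Definition weakly_redescription_invariant :=
  forall P P' : description n, periodic_unit P -> periodic_unit P' ->
    PtoS P' = PtoS P -> g P' = g P.

(* g o (PtoS restricted to P_n)^-1 *)
Definition induced_map : partial_map Y := fun S =>
  if pselect (exists2 P : description n, periodic_unit P & PtoS P = S) is left h
  then Some (g (projT1 (cid2 h))) else None.

Lemma Dom_induced_map :
  Dom induced_map = [set PtoS P | P in @periodic_unit n].
Proof.
apply/seteqP; split=> S; rewrite /Dom /induced_map /=.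
- by case: (pselect _) => // h [].
- by case: (pselect _) => // h _; exists (g (projT1 (cid2 h))).
Qed.

Lemma induced_mapE : weakly_redescription_invariant ->
  forall P : description n, periodic_unit P -> induced_map (PtoS P) = Some (g P).
Proof.
move=> gP P uP; rewrite /induced_map; case: (pselect _) => [h|[]]; last by exists P.
by case: cid2 => P' uP' /= e; rewrite (gP P P').
Qed.

End redescription.

End solid_materials.

(* An edge feature is a function of a distance, whence continuity on [0, +oo[.
   The same message function is used at every update. *)
Record cgcnn (R : realType) (species : finType) := CGCNN {
  cutoff : R;
  node_dim : nat;
  edge_dim : nat;
  num_updates : nat;
  node_init : species -> 'rV[R]_node_dim;
  edge_feature : R -> 'rV[R]_edge_dim;
  message : 'rV[R]_node_dim -> 'rV[R]_node_dim -> 'rV[R]_edge_dim ->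
            'rV[R]_node_dim;
  readout : 'rV[R]_node_dim -> R;
  cutoff_gt0 : 0 < cutoff;
  edge_feature_continuous : {within `[0, +oo[, continuous edge_feature};
  message_continuous :
    continuous (fun x : 'rV[R]_node_dim * 'rV[R]_node_dim * 'rV[R]_edge_dim =>
      message x.1.1 x.1.2 x.2);
  readout_continuous : continuous readout
}.

Section energy.
Variables (R : realType) (species : finType) (G : cgcnn R species).
Variables (n : nat) (P : description R species n).

(* ||x_j + L k - x_i|| for jk = (j, k) *)
Definition edge_length (i : 'I_n) (jk : 'I_n * 'cV[int]_3) : R :=
  enorm (site P jk.1 jk.2 - col i (coordinates P)).

Definition neighbours (i : 'I_n) : set ('I_n * 'cV[int]_3) :=
  [set jk | edge_length i jk < cutoff G].

(* The sum is over a finite set as soon as the lattice basis is invertible. *)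
Definition update (v : 'I_n -> 'rV[R]_(node_dim G)) (i : 'I_n) :
    'rV[R]_(node_dim G) :=
  v i + \sum_(jk \in neighbours i)
    cos (pi * edge_length i jk / (2 * cutoff G)) ^+ 2 *:
      message (v i) (v jk.1) (edge_feature G (edge_length i jk)).

Definition node_features : 'I_n -> 'rV[R]_(node_dim G) :=
  iter (num_updates G) update (fun i => node_init G (tnth (species_vector P) i)).

Definition energy : R :=
  readout (n%:R^-1 *: \sum_(i < n) node_features i).

End energy.

Section lebesgue_tuple.
Variable R : realType.
Local Notation RM := (measurableTypeR R).

Definition tuple_cons d (p : RM * d.-tuple RM) : d.+1.-tuple RM :=
  [tuple of p.1 :: p.2].

Lemma measurable_tuple_cons d : measurable_fun [set: RM * d.-tuple RM] (@tuple_cons d).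
Proof. exact: (measurable_cons measurable_fst measurable_snd). Qed.

Lemma measurable_tuple_uncons d :
  measurable_fun [set: d.+1.-tuple RM] (fun t => (thead t, [tuple of behead t])).
Proof.
apply: measurable_fun_pair; first exact: measurable_tnth.
exact: measurable_behead.
Qed.

Section cons_measure.
Variables (d : nat) (mu : {sigma_finite_measure set (d.-tuple RM) -> \bar R}).

Definition cons_measure : set (d.+1.-tuple RM) -> \bar R :=
  pushforward (@lebesgue_measure R \x mu)%E (@tuple_cons d).

Let cons_measure0 : cons_measure set0 = 0%E.
Proof. have mf := @measurable_tuple_cons d; exact: measure0. Qed.

Let cons_measure_ge0 A : (0 <= cons_measure A)%E.
Proof. have mf := @measurable_tuple_cons d; exact: measure_ge0. Qed.

Let cons_measure_sigma_additive : semi_sigma_additive cons_measure.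
Proof.
have mf := @measurable_tuple_cons d; exact: measure_semi_sigma_additive.
Qed.

HB.instance Definition _ := isMeasure.Build _ _ _ cons_measure
  cons_measure0 cons_measure_ge0 cons_measure_sigma_additive.

Let cons_measure_sigma_finite : sigma_finite setT cons_measure.
Proof.
have /sigma_finiteP[F [FT ndF Foo]] := sigma_finiteT (@lebesgue_measure R).
have /sigma_finiteP[H [HT ndH Hoo]] := sigma_finiteT mu.
pose g (t : d.+1.-tuple RM) := (thead t, [tuple of behead t]).
have gK : cancel (@tuple_cons d) g.
  by move=> [x t]; congr pair; apply: val_inj.
exists (fun k => g @^-1` (F k `*` H k)).
  rewrite -preimage_bigcup (_ : \bigcup_k _ = setT) ?preimage_setT//.
  rewrite -subTset => -[x t] _.
  have [i _ Fx] : (\bigcup_k F k) x by rewrite -FT.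
  have [j _ Ht] : (\bigcup_k H k) t by rewrite -HT.
  exists (maxn i j) => //; split => /=.
  - by move: x Fx; exact/subsetPset/ndF/leq_maxl.
  - by move: t Ht; exact/subsetPset/ndH/leq_maxr.
move=> k; have [mF Foo'] := Foo k; have [mH Hoo'] := Hoo k; split.
  rewrite -[X in measurable X]setTI.
  by apply: measurable_tuple_uncons => //; exact: measurableX.
rewrite /cons_measure /pushforward (_ : _ @^-1` _ = F k `*` H k).
  by rewrite product_measure1E// lte_mul_pinfty// ge0_fin_numE.
by apply/funext => x; rewrite /preimage /mkset gK.
Qed.

HB.instance Definition _ :=
  Measure_isSigmaFinite.Build _ _ _ cons_measure cons_measure_sigma_finite.

End cons_measure.

(* The Lebesgue measure on R^d; R^0 is a point of mass 1. *)
Fixpoint lebesgue_tuple d : {sigma_finite_measure set (d.-tuple RM) -> \bar R} :=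
  if d is d'.+1 then cons_measure (lebesgue_tuple d')
  else \d_([tuple] : 0.-tuple RM).

Lemma lebesgue_tuple_box d (a b : 'I_d -> R) : (forall i, a i <= b i) ->
  lebesgue_tuple d [set t | forall i, a i <= tnth t i <= b i] =
  (\prod_(i < d) (b i - a i))%:E.
Proof.
elim: d a b => [|d IHd] a b ab.
  rewrite big_ord0 /= diracE mem_set//.
  by case.
rewrite big_ord_recl EFinM -IHd => [/=|i]; last exact: ab.
rewrite /cons_measure /pushforward.
rewrite (_ : _ @^-1` _ = `[a ord0, b ord0] `*`
    [set t | forall i, a (lift ord0 i) <= tnth t i <= b (lift ord0 i)]).
  rewrite product_measure1E//; last first.
    rewrite (_ : mkset _ = \bigcap_(i in [set: 'I_d])
      ((fun t : d.-tuple RM => tnth t i) @^-1` `[a (lift ord0 i), b (lift ord0 i)])).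
      apply: fin_bigcap_measurable => // i _.
      by rewrite -[X in measurable X]setTI; exact: measurable_tnth.
    apply/seteqP; split => t /= Ht i; last by have := Ht i I; rewrite /= in_itv.
    by move=> _; rewrite /= in_itv; exact: Ht.
  congr (_ * _)%E.
  have := @lebesgue_measure_itv R `[a ord0, b ord0]; rewrite /= lte_fin => ->.
  case: ltP => // ba.
  by rewrite (_ : b ord0 = a ord0) ?subrr//; apply/eqP; rewrite eq_le ba ab.
apply/seteqP; split=> -[x t] /=.
- move=> Ht; split; first by have := Ht ord0; rewrite in_itv/= tnth0.
  by move=> i; have := Ht (lift ord0 i); rewrite tnthS.
- by rewrite in_itv/= => -[Hx Ht] i; case: (unliftP ord0 i) => [j|] ->;
    rewrite ?tnthS ?tnth0.
Qed.

End lebesgue_tuple.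

Section conditional_density.
Variables (R : realType) (species : finType) (G : cgcnn R species).
Local Notation RM := (measurableTypeR R).

(* The identification of R^(m * p) with the m x p matrices. *)
Definition tuple_mx m p (t : (m * p).-tuple RM) : 'M[R]_(m, p) :=
  vec_mx (\row_k (tnth t k : R)).

(* The energy is defined for periodic units only; the pairs (X, L) that do not
   form a periodic unit with A are a null set and are left out. *)
Definition partition_function (beta : R) n (A : n.-tuple species) : \bar R :=
  let P (z : (3 * n).-tuple RM * (3 * 3).-tuple RM) :=
    Description A (tuple_mx z.1) (tuple_mx z.2) in
  (\int[lebesgue_tuple R (3 * n) \x lebesgue_tuple R (3 * 3)]_(z in
      [set z | periodic_unit (P z)]) (expR (- beta * energy G (P z)))%:E)%E.

(* exp(- beta H) / Z. The integral Z diverges: at low density an atom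
   has no neighbour but itself, and the integrand is a positive constant on a
   set of infinite measure. Hence [to_real] : \bar R -> R, any map such that
   [to_real r%:E = r]; its value at +oo is the convention for a divergent Z.
   For instance [to_real := fine] yields exp(- beta H) / +oo = 0, and
   [to_real +oo = 1] yields the unnormalized weight exp(- beta H). *)
Definition conditional_density (to_real : \bar R -> R) (beta : R) n
    (P : description R species n) : R :=
  expR (- beta * energy G P) / to_real (partition_function beta (species_vector P)).

End conditional_density.

(* Main.v *)
(* The partition function is infinite: when the atoms are further apart than the
   cutoff in all periodic images, the energy is a constant depending on A only,
   and such (X, L) fill boxes of arbitrarily large volume. Hence the density is a
   fixed continuous function of the energy.

   All claims but the two isometry invariances then follow from one estimate:
   if the atoms of PtoS P' match those of PtoS P up to a small displacement, then
   their energies are close; equality of the two materials is the case of zero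
   displacement. Node features are attached to the atoms of the material and are
   continuous under such a matching, because the envelope cos^2 vanishes at the
   cutoff. Since the matching need not respect the lattices, the means over the
   n cells are compared by averaging over large windows of one of the two
   lattices, which meet each of the n atom types of the other equally often up to
   a boundary term. *)
Require Import Defs.
From mathcomp Require Import all_boot all_order all_algebra.
From mathcomp Require Import finmap.
From mathcomp Require Import all_classical all_reals all_analysis.
From mathcomp Require Import ring lra zify.
Set Implicit Arguments.
Unset Strict Implicit.
Unset Printing Implicit Defensive.
Import Order.TTheory GRing.Theory Num.Theory.
Import numFieldNormedType.Exports.
Local Open Scope classical_set_scope.
Local Open Scope ring_scope.

(** * Geometry and the edge terms *)

Section geometry.
Variable R : realType.
Implicit Types x y z : 'cV[R]_3.

Lemma enorm_ge0 x : 0 <= enorm x.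
Proof. exact: sqrtr_ge0. Qed.

Lemma enorm0 : enorm (0 : 'cV[R]_3) = 0.
Proof. by rewrite /enorm big1 ?sqrtr0// => i _; rewrite mxE expr0n. Qed.

Lemma entry_le_enorm x i : `|x i 0| <= enorm x.
Proof.
rewrite -(sqrtr_sqr (x i 0)) /enorm ler_wsqrtr// (bigD1 i)//= lerDl.
by apply: sumr_ge0 => j _; exact: sqr_ge0.
Qed.

Lemma mx_norm_le m p (M : 'M[R]_(m, p)) (c : R) : 0 <= c ->
  (forall i j, `|M i j| <= c) -> `|M| <= c.
Proof.
move=> c0 Mc; rewrite /Num.norm/= mx_normrE.
by apply/bigmax_leP; split => // -[i j] _ /=.
Qed.

Lemma entry_le_mx_norm m p (M : 'M[R]_(m, p)) i j : `|M i j| <= `|M|.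
Proof.
rewrite [leRHS]/Num.norm/= mx_normrE.
by apply/bigmax_geP; right; exists (i, j).
Qed.

(** Displacements and the cutoff are Euclidean; the estimates below run in the max norm and rely on
    this bound. *)
Lemma mx_norm_le_enorm x : `|x| <= enorm x.
Proof.
apply: mx_norm_le; first exact: enorm_ge0.
by move=> i j; rewrite ord1; exact: entry_le_enorm.
Qed.

Lemma mulmx_norm_le m p q (M : 'M[R]_(m, p)) (N : 'M[R]_(p, q)) :
  `|M *m N| <= p%:R * (`|M| * `|N|).
Proof.
apply: mx_norm_le => [|i j]; first by rewrite !mulr_ge0.
rewrite mxE (le_trans (ler_norm_sum _ _ _))//.
have -> : p%:R * (`|M| * `|N|) = \sum_(k < p) `|M| * `|N|.
  by rewrite sumr_const card_ord mulr_natl.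
by apply: ler_sum => k _; rewrite normrM ler_pM ?entry_le_mx_norm.
Qed.

Lemma enorm_orthogonal (Q : 'M[R]_3) x : Q^T *m Q = 1%:M -> enorm (Q *m x) = enorm x.
Proof.
have dot z : \sum_(i < 3) z i 0 ^+ 2 = (z^T *m z) 0 0.
  by rewrite mxE; apply: eq_bigr => i _; rewrite mxE expr2.
move=> QQ; rewrite /enorm !dot trmx_mul mulmxA.
by rewrite -(mulmxA x^T) QQ mulmx1.
Qed.

Lemma enorm_continuous : continuous (@enorm R).
Proof.
have cs : continuous (fun x : 'cV[R]_3 => \sum_(i < 3) (x i 0 : R^o) ^+ 2).
  apply: continuous_big; first exact: add_continuous.
  move=> i _ x; apply: (@continuous_comp _ _ _ (fun x : 'cV[R]_3 => x i 0 : R)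
    (fun r : R => r ^+ 2)); first exact: coord_continuous.
  exact: exprn_continuous.
by move=> x; apply: (continuous_comp (cs x)); exact: sqrt_continuous.
Qed.

End geometry.

Section kernel.
Variables (R : realType) (species : finType) (G : cgcnn R species).
Local Notation V := 'rV[R]_(node_dim G).

(* Truncating the length at the cutoff makes this continuous in [z] and zero
   beyond the cutoff, since cos (pi / 2) = 0. *)
Definition edge_term (u v : V) (z : 'cV[R]_3) : V :=
  cos (pi * Num.min (enorm z) (cutoff G) / (2 * cutoff G)) ^+ 2 *:
    message u v (edge_feature G (enorm z)).

Lemma edge_term_eq0 u v z : cutoff G <= enorm z -> edge_term u v z = 0.
Proof.
have G0 := cutoff_gt0 G.
move=> zG; rewrite /edge_term min_r// (_ : _ / _ = pi / 2) ?cos_pihalf.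
  by rewrite expr0n/= scale0r.
by field; rewrite gt_eqF.
Qed.

Lemma edge_term_continuous :
  continuous (fun p : V * V * 'cV[R]_3 => edge_term p.1.1 p.1.2 p.2).
Proof.
move=> [[u v] z]; rewrite /edge_term/=.
have cz : (fun p : V * V * 'cV[R]_3 => enorm p.2) @ (u, v, z) --> enorm z.
  by apply: (@cvg_comp _ _ _ snd (@enorm R) _ (nbhs z));
    [exact: cvg_snd|exact: enorm_continuous].
apply: cvgZ.
  apply: (@cvg_comp _ _ _
    (fun p : V * V * 'cV[R]_3 =>
       cos (pi * Num.min (enorm p.2) (cutoff G) / (2 * cutoff G)))
    (fun r => r ^+ 2) _
    (nbhs (cos (pi * Num.min (enorm z) (cutoff G) / (2 * cutoff G)))));
    last exact: exprn_continuous.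
  apply: continuous_cvg; first exact: continuous_cos.
  apply: cvgM; last exact: cvg_cst.
  apply: cvgM; first exact: cvg_cst.
  apply: (@continuous_min _ _ (fun p : V * V * 'cV[R]_3 => enorm p.2)
    (fun=> cutoff G) (u, v, z)); [exact: cz|exact: cvg_cst].
(* [edge_feature] is continuous within [0, +oo[ only, where all values of [enorm] lie. *)
have ce : (fun p : V * V * 'cV[R]_3 => edge_feature G (enorm p.2)) @ (u, v, z) -->
    edge_feature G (enorm z).
  have /subspace_continuousP/(_ (enorm z)) := @edge_feature_continuous _ _ G.
  rewrite /= in_itv/= enorm_ge0/= => /(_ erefl) ce.
  apply: (@cvg_comp _ _ _ (fun p : V * V * 'cV[R]_3 => enorm p.2) _ _ _ _ _ ce).
  move=> A /= /cz; rewrite /nbhs /=; apply: filterS => p /=; apply.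
  by rewrite /= in_itv/= enorm_ge0.
have cf : (fun p : V * V * 'cV[R]_3 => p.1) @ (u, v, z) --> (u, v).
  exact: cvg_fst.
have cp := cvg_pair cf ce.
have cm := @message_continuous _ _ G ((u, v), edge_feature G (enorm z)).
exact: (cvg_comp _ _ (cp _ _ _) cm).
Qed.

(** As [edge_term] vanishes from the cutoff on, the index set need not depend on P, which permits
    reindexing between descriptions. *)
Lemma updateE n (P : description R species n) (v : 'I_n -> V) i :
  update P v i =
  v i + \sum_(jk \in [set: 'I_n * 'cV[int]_3])
          edge_term (v i) (v jk.1) (site P jk.1 jk.2 - col i (coordinates P)).
Proof.
rewrite /update; congr (_ + _).
rewrite -(@fsbig_widen _ _ _ _ (neighbours G P i) setT)//=; last first.
  move=> jk [_ /=]; rewrite /neighbours/= => /negP; rewrite -leNgt => jkG.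
  by rewrite edge_term_eq0.
apply: eq_fsbigr => jk; rewrite inE /neighbours /= => /ltW jkG.
by rewrite /edge_term min_l.
Qed.

End kernel.

(** * Averages over windows *)

Section windows.
Variable n : nat.
Local Notation index := ('I_n * 'cV[int]_3)%type.

(** The cube [-N, N]^3 of cells is parametrised by matrices over a finite type, which makes counting
    immediate. *)
Definition window_cell N (s : 'I_n * 'cV['I_N.*2.+1]_3) : index :=
  (s.1, map_mx (fun a : 'I_N.*2.+1 => (a : nat)%:Z - N%:Z) s.2).

Definition window N : {fset index} :=
  [fset window_cell s | s : 'I_n * 'cV['I_N.*2.+1]_3]%fset.

Lemma window_cell_inj N : injective (@window_cell N).
Proof.
move=> [i k] [j l] [<- kl]; congr pair; apply/matrixP => a b.
have /matrixP/(_ a b) := kl; rewrite !mxE => /addIr[?]; exact: val_inj.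
Qed.

Lemma mem_window N (s : index) :
  reflect (forall a, (`|s.2 a ord0| <= N)%N) (s \in window N).
Proof.
apply: (iffP (imfsetP _ _ _ _)) => [[[i k] _ ->] a /=|sN].
  by rewrite mxE; case: (k a ord0) => b /=; lia.
exists (s.1, \col_a inord (absz (s.2 a ord0 + N%:Z))) => //.
case: s sN => i k /= kN; congr pair; apply/matrixP => a b.
rewrite (ord1 b) !mxE; move: (k a ord0) (kN a) => r rN.
by rewrite inordK; lia.
Qed.

Lemma sum_window (V : zmodType) N (w : 'I_n -> V) :
  \sum_(s <- window N) w s.1 = (\sum_i w i) *+ (N.*2.+1 ^ 3).
Proof.
rewrite big_imfset/=; last by move=> ? ? _ _; exact: window_cell_inj.
rewrite big_enum/= -(pair_bigA _ (fun i (k : 'cV['I_N.*2.+1]_3) => w i))/=.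
rewrite -sumrMnl; apply: eq_bigr => i _.
by rewrite sumr_const card_mx card_ord.
Qed.

Lemma card_window N : #|` window N| = (n * N.*2.+1 ^ 3)%N.
Proof.
have := sum_window N (fun=> 1%:Z).
rewrite big_const_seq count_predT iter_addr addr0 sumr_const card_ord => /eqP.
by rewrite -mulrnA !natz eqz_nat => /eqP.
Qed.

(* The number [c N j] of cells of the window that Phi sends to type j hardly
   depends on j: changing the type of Phi s from j to j' and pulling back by Psi
   moves s by at most C, hence out of the window only near its boundary, which
   is negligible as N grows. *)
Lemma shared_windows_mean (R : realType) (V : normedModType R)
    (Phi Psi : index -> index) (C : nat) (u w : 'I_n -> V) (e : R) :
  cancel Phi Psi -> cancel Psi Phi ->
  (forall j s a, (`|(Psi (j, (Phi s).2)).2 a ord0 - s.2 a ord0| <= C)%N) ->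
  0 <= e -> (forall s, `|u (Phi s).1 - w s.1| <= e) ->
  `|\sum_i u i - \sum_i w i| <= n%:R * e.
Proof.
move=> PhiK PsiK near_id e0 uw.
pose c N j := (\sum_(s <- window N) ((Phi s).1 == j : nat))%N.
pose D N := (#|` window (N + C)| - #|` window N|)%N.
have winS N : (window N `<=` window (N + C))%fset.
  by apply/fsubsetP => s /mem_window sN; apply/mem_window => a; have := sN a; lia.
have cE N j : c N j = #|` [fset s in window N | (Phi s).1 == j]%fset|.
  rewrite /c -sum1_size big_fset/= [RHS]big_mkcond/=.
  by apply: eq_bigr => s _; case: eqP.
have cD N j j' : (c N j <= c N j' + D N)%N.
  rewrite !cE.
  (* [g] is injective on the cells of type j, and its values have type j' and lie in
     [window (N + C)]. *)
  pose g s := Psi (j', (Phi s).2).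
  have <- : #|` (g @` [fset s in window N | (Phi s).1 == j])%fset| =
      #|` [fset s in window N | (Phi s).1 == j]%fset|.
    apply: card_in_imfset.
    move=> s t; rewrite !inE => /andP[_ /eqP sj] /andP[_ /eqP tj] /(can_inj PsiK) [st].
    by apply: (can_inj PhiK);
      rewrite (surjective_pairing (Phi s)) sj st -tj -surjective_pairing.
  apply: (@leq_trans #|` ([fset s in window N | (Phi s).1 == j'] `|`
    (window (N + C) `\` window N))%fset|).
    apply: fsubset_leq_card; apply/fsubsetP => _ /imfsetP[s /= + ->].
    rewrite !inE => /andP[/mem_window sN _].
    rewrite PsiK eqxx andbT; case: (boolP (_ \in window N)) => //= _.
    apply/mem_window => a; have := sN a; have := near_id j' s a.
    by rewrite /g; move: (fun_of_matrix _ _ _) (fun_of_matrix _ _ _) => x y; lia.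
  by rewrite (leq_trans (leq_card_fsetU _ _))// leq_add2l cardfsDS.
have sum_c N : (\sum_j c N j = n * N.*2.+1 ^ 3)%N.
  rewrite -card_window exchange_big/= -sum1_size; apply: eq_bigr => s _.
  by rewrite (bigD1 (Phi s).1)//= eqxx big1// => i /negbTE; rewrite eq_sym => ->.
have sum_const x : (\sum_(i < n) x = n * x)%N by rewrite sum_nat_const card_ord.
(* Summing [cD] over one of its two types compares n copies of [c N j] with the total; then n
   cancels. *)
have c_bounds N j : (c N j <= N.*2.+1 ^ 3 + D N)%N /\ (N.*2.+1 ^ 3 <= c N j + D N)%N.
  have n0 : (0 < n)%N by case: (n) j => // -[].
  by split; rewrite -(leq_pmul2l n0) mulnDr -sum_c -!sum_const -big_split leq_sum.
have sum_u N : \sum_(s <- window N) u (Phi s).1 = \sum_j u j *+ c N j.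
  under [RHS]eq_bigr do rewrite -sumrMnr.
  rewrite exchange_big/=; apply: eq_bigr => s _.
  rewrite (bigD1 (Phi s).1)//= eqxx big1 ?addr0// => i /negbTE.
  by rewrite eq_sym => ->.
pose K := \sum_j `|u j|.
(* The window sum contains [u j] exactly [c N j] times instead of (2N+1)^3; the first term pays for
   this, the second for the pointwise error e. *)
have bound N : `|\sum_i u i - \sum_i w i| * (N.*2.+1 ^ 3)%:R <=
    (D N)%:R * K + (n * N.*2.+1 ^ 3)%:R * e.
  have -> : `|\sum_i u i - \sum_i w i| * (N.*2.+1 ^ 3)%:R =
      `|\sum_j ((N.*2.+1 ^ 3)%:R - (c N j)%:R) *: u j +
        \sum_(s <- window N) (u (Phi s).1 - w s.1)|.
    rewrite mulr_natr -normrMn; congr (`|_|).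
    under [X in _ = X + _]eq_bigr do rewrite scalerBl !scaler_nat.
    rewrite !sumrB sum_u addrA subrK sum_window mulrnBl; congr (_ - _).
    by rewrite sumrMnl.
  rewrite (le_trans (ler_normD _ _))// lerD//.
    rewrite mulr_sumr (le_trans (ler_norm_sum _ _ _))// ler_sum// => j _.
    rewrite normrZ ler_wpM2r// ler_distlC.
    have [] := c_bounds N j; rewrite -!(ler_nat R) !natrD.
    by move: (_%:R) => ? ? ?; apply/andP; split; lra.
  rewrite (le_trans (ler_norm_sum _ _ _))//.
  rewrite -card_window -sum1_size natr_sum mulr_suml.
  by apply: ler_sum => s _; rewrite mul1r.
(* A positive excess X would satisfy X (2N+1) <= E for every N. *)
rewrite -subr_le0; set X := _ - _; rewrite leNgt; apply/negP => X0.
(* With M = 2N+1, (M + 2C)^3 - M^3 = 6 C M^2 + 12 C^2 M + 8 C^3 is at most 26 (C+1)^3 M^2, where 26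
   = 6 + 12 + 8. *)
pose E := K * n%:R * 26 * C.+1%:R ^+ 3.
have boundX N : X * N.*2.+1%:R <= E.
  have M0 : 0 < N.*2.+1%:R ^+ 2 :> R by rewrite exprn_gt0.
  rewrite -(ler_pM2r M0).
  have := bound N.
  rewrite /D natrB ?fsubset_leq_card// !card_window.
  rewrite !(natrM _ n) !natrX (_ : (N + C).*2.+1 = N.*2.+1 + C.*2)%N; last by lia.
  rewrite natrD -[C.*2]muln2 natrM /X /E.
  have : 1 <= N.*2.+1%:R :> R by rewrite ler1n.
  rewrite -[C.+1%:R]natr1.
  have : 0 <= C%:R :> R by [].
  have : 0 <= K by apply: sumr_ge0.
  have : 0 <= n%:R :> R by [].
  move: (N.*2.+1%:R) (C%:R) (n%:R) (`|_ - _|) => M c' n' S n0 K0 c0 M1 SM.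
  have : c' ^+ 2 * M <= c' ^+ 2 * M ^+ 2.
    by rewrite ler_wpM2l ?sqr_ge0// expr2 ler_peMr//; lra.
  have : c' ^+ 3 <= c' ^+ 3 * M ^+ 2 by rewrite ler_peMr ?exprn_ge0// exprn_ege1.
  set p := c' ^+ 2 * M; set q := c' ^+ 2 * M ^+ 2; set r := c' ^+ 3 * M ^+ 2 => rM pq.
  have : n' * K * (6 * (c' * M ^+ 2) + 12 * p + 8 * c' ^+ 3) <=
         n' * K * (26 * (c' + 1) ^+ 3 * M ^+ 2).
    rewrite ler_wpM2l ?mulr_ge0//.
    have : 0 <= M ^+ 2 by rewrite sqr_ge0.
    have : 0 <= c' * M ^+ 2 by rewrite mulr_ge0 ?sqr_ge0.
    have : 0 <= q by rewrite mulr_ge0 ?sqr_ge0.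
    have : 0 <= r by rewrite mulr_ge0 ?sqr_ge0 ?exprn_ge0.
    rewrite (_ : 26 * (c' + 1) ^+ 3 * M ^+ 2 =
      26 * (r + 3 * q + 3 * (c' * M ^+ 2) + M ^+ 2)); last by rewrite /r /q; ring.
    move: (M ^+ 2) (c' * _) => ? ?; lra.
  rewrite /p; nra.
have E0 : 0 <= E by rewrite !mulr_ge0// ?exprn_ge0 ?sumr_ge0.
have := boundX (Num.bound (E / X)).
apply/negP; rewrite -ltNge -ltr_pdivrMl// mulrC.
apply: (lt_le_trans (archi_boundP _)); first by rewrite divr_ge0// ltW.
by rewrite ler_nat; move: (Num.bound _) => b; lia.
Qed.

End windows.

(** * Matched periodic units and continuity of the energy *)

Section periodic_units.
Variables (R : realType) (species : finType) (n : nat).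
Local Notation index := ('I_n * 'cV[int]_3)%type.
Implicit Types P : description R species n.

Lemma siteD P j k l :
  site P j (k + l) = site P j k + lattice P *m map_mx intr l.
Proof. by rewrite /site map_mxD mulmxDr addrA. Qed.

Lemma siteB P j k l :
  site P j (k - l) = site P j k - lattice P *m map_mx intr l.
Proof. by rewrite siteD map_mxN mulmxN. Qed.

Lemma site0 P j : site P j 0 = col j (coordinates P).
Proof. by rewrite /site map_mx0 mulmx0 addr0. Qed.

(** Neighbours of any cell can thus be measured from cell 0, and one window serves all cells. *)
Lemma siteB_shift P j k i l :
  site P j (l + k) - site P i l = site P j k - site P i 0.
Proof.
rewrite addrC siteD site0 /site; move: (_ *m _) (_ *m _) => x y.
by apply/matrixP => ? ?; rewrite !mxE; ring.
Qed.

Lemma site_inj P : periodic_unit P -> injective (fun s : index => site P s.1 s.2).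
Proof.
move=> [_ Pdisj] [i k] [j l] /= ijkl.
have := Pdisj i j (l - k).
rewrite siteB -ijkl /site addrK => Pij.
have [ij|] := eqVneq i j; last by move=> /eqP ij; case: Pij => //; left.
have [/eqP|/eqP lk] := eqVneq (l - k) 0; last by case: Pij => //; right.
by rewrite subr_eq0 ij => /eqP ->.
Qed.

(** Write k as L^-1 (L k); the factor 3 is the inner dimension in [mulmx_norm_le]. *)
Lemma lattice_bounded (L : 'M[R]_3) (B : R) : L \in unitmx ->
  exists C : nat, forall k : 'cV[int]_3,
    `|L *m map_mx intr k| <= B -> forall a, (`|k a ord0| <= C)%N.
Proof.
move=> Lu; exists (Num.bound (3%:R * (`|invmx L| * B))) => k LkB a.
rewrite -(ler_nat R) natr_absz intr_norm.
apply/ltW/(le_lt_trans _ (archi_boundP _)); last first.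
  by rewrite !mulr_ge0// (le_trans _ LkB).
have -> : (k a ord0)%:~R = (map_mx intr k : 'cV[R]_3) a 0 by rewrite mxE.
rewrite (le_trans (entry_le_mx_norm _ _ _))//.
rewrite -{1}(mulKmx Lu (map_mx intr k)).
rewrite (le_trans (mulmx_norm_le _ _))// ler_wpM2l// ler_wpM2l//.
Qed.

(** Two base points differ by at most twice the norm of the coordinate matrix, which bounds the
    lattice part of the difference. *)
Lemma site_near P (B : R) : lattice P \in unitmx ->
  exists C : nat, forall i j (k l : 'cV[int]_3),
    `|site P j l - site P i k| <= B -> forall a, (`|l a ord0 - k a ord0| <= C)%N.
Proof.
move=> /(lattice_bounded (B + 2 * `|coordinates P|))[C PC].
exists C => i j k l klB a.
have -> : l a ord0 - k a ord0 = (l - k) a ord0 by rewrite !mxE.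
apply: PC.
have -> : lattice P *m map_mx intr (l - k) =
   (site P j l - site P i k) - (col j (coordinates P) - col i (coordinates P)).
  rewrite /site map_mxB mulmxBr; move: (_ *m _) (_ *m _) (col _ _) (col _ _) => x y z t.
  by apply/matrixP => ? ?; rewrite !mxE; ring.
rewrite (le_trans (ler_normB _ _))// lerD// (le_trans (ler_normB _ _))//.
have colX m : `|col m (coordinates P)| <= `|coordinates P|.
  by apply: mx_norm_le => // ? ?; rewrite mxE entry_le_mx_norm.
by rewrite mulrDl mul1r lerD.
Qed.

(* Phi re-indexes the sites of P by those of P', each atom moving by less than d
   (in max norm); it need not respect the lattices. *)
Record matching (d : R) P P' (Phi Psi : index -> index) : Prop := Matching {
  matchingK : cancel Phi Psi;
  matchingVK : cancel Psi Phi;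
  matching_species s :
    tnth (species_vector P') (Phi s).1 = tnth (species_vector P) s.1;
  matching_dist s :
    `|site P' (Phi s).1 (Phi s).2 - site P s.1 s.2| < d
}.

(** Sites of a periodic unit are pairwise distinct, so the bijection of atoms lifts to one of
    indices. *)
Lemma close_matching (d : R) P P' : periodic_unit P -> periodic_unit P' ->
  close_materials d (PtoS P) (PtoS P') -> exists Phi Psi, matching d P P' Phi Psi.
Proof.
move=> uP uP' [phi [phiS phi_inj phi_surj] phid].
pose atom (Q : description R species n) (s : index) :=
  (tnth (species_vector Q) s.1, site Q s.1 s.2).
have atom_inj Q : periodic_unit Q -> injective (atom Q).
  by move=> uQ s t [_ /(site_inj uQ)].
have atomS Q s : PtoS_set Q (atom Q s) by exists s.
have /choice[Phi PhiE] : forall s, exists t, atom P' t = phi (atom P s).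
  by move=> s; have /= [t _ <-] := phiS _ (atomS P s); exists t.
have /choice[Psi PsiE] : forall t, exists s, phi (atom P s) = atom P' t.
  by move=> t; have /= [_ [s _ <-] <-] := phi_surj _ (atomS P' t); exists s.
have PsiK : cancel Psi Phi.
  by move=> t; apply: (atom_inj P' uP'); rewrite PhiE PsiE.
have PhiK : cancel Phi Psi.
  move=> s; apply: (atom_inj P uP); apply: phi_inj; rewrite ?inE //=; try exact: atomS.
  by rewrite PsiE PhiE.
exists Phi, Psi; split => // s; have [] := phid _ (atomS P s); rewrite -PhiE//=.
by move=> _; apply: le_lt_trans; exact: mx_norm_le_enorm.
Qed.

(** Changing the type of [Phi s] inside its cell of P' moves it by at most twice the norm of the
    coordinates of P', and the matching, used twice, adds at most 2d; [site_near] turns this into a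
    bound C on cells. C depends on P', but the final bound does not. *)
Lemma matching_sum (V : normedModType R) (d : R) P P' Phi Psi
    (u w : 'I_n -> V) (e : R) :
  lattice P \in unitmx -> matching d P P' Phi Psi -> 0 <= e ->
  (forall s, `|u (Phi s).1 - w s.1| <= e) ->
  `|\sum_i u i - \sum_i w i| <= n%:R * e.
Proof.
move=> Lu [PhiK PsiK _ PhiD] e0 uw.
have [C PC] := site_near (d + d + 2 * `|coordinates P'|) Lu.
apply: (@shared_windows_mean _ _ _ Phi Psi C) => // j s.
apply: PC (s.1) (Psi (j, (Phi s).2)).1 _ _ _.
have := PhiD s; have := PhiD (Psi (j, (Phi s).2)); rewrite PsiK /=.
set t := Psi _ => dt ds.
have -> : site P t.1 t.2 - site P s.1 s.2 =
  (site P' (Phi s).1 (Phi s).2 - site P s.1 s.2)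
  - (site P' j (Phi s).2 - site P t.1 t.2)
  + (col j (coordinates P') - col (Phi s).1 (coordinates P')).
  rewrite [site P' (Phi s).1 _]/site [site P' j _]/site.
  move: (site P _ _) (site P _ _) (_ *m _) (col _ _) (col _ _) => x y z v q.
  by apply/matrixP => ? ?; rewrite !mxE; ring.
rewrite (le_trans (ler_normD _ _))// lerD//.
  by rewrite (le_trans (ler_normB _ _))// lerD// ltW.
have colX m : `|col m (coordinates P')| <= `|coordinates P'|.
  by apply: mx_norm_le => // ? ?; rewrite mxE entry_le_mx_norm.
by rewrite mulrDl mul1r (le_trans (ler_normB _ _))// lerD.
Qed.

End periodic_units.

Lemma near_seq (T : Type) (F : set_system T) (I : eqType) (s : seq I)
    (Q : I -> T -> Prop) :
  Filter F -> (forall i, i \in s -> \forall t \near F, Q i t) ->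
  \forall t \near F, forall i, i \in s -> Q i t.
Proof.
move=> FF; elim: s => [|i s IHs] sQ; first by apply: filterE => t j; rewrite in_nil.
have Qi := sQ i (mem_head _ _).
have Qs : \forall t \near F, forall j, j \in s -> Q j t.
  by apply: IHs => j js; apply: sQ; rewrite inE js orbT.
by apply: filterS2 Qi Qs => t Qi Qs j; rewrite inE => /orP[/eqP ->|/Qs].
Qed.

Lemma continuous_at_right0 (R : realType) (U V : normedModType R) (f : U -> V)
    (p : U) (e : R) :
  {for p, continuous f} -> 0 < e ->
  \forall d \near 0^'+, forall q, `|q - p| < d -> `|f q - f p| < e.
Proof.
move=> fp e0.
have /cvgrPdist_lt/(_ e e0)/nbhs_ballP[d /= d0 pd] := fp.
near=> h => q qp; rewrite distrC; apply: pd.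
rewrite -ball_normE /ball_/= distrC (lt_trans qp)//.
Unshelve. all: by end_near. Qed.

Section features.
Variables (R : realType) (species : finType) (G : cgcnn R species) (n : nat).
Local Notation index := ('I_n * 'cV[int]_3)%type.
Local Notation V := 'rV[R]_(node_dim G).
Implicit Types P : description R species n.

(** The number of updates is a parameter, for induction; [num_updates G] gives [node_features]. *)
Definition features P t : 'I_n -> V :=
  iter t (update P) (fun i => node_init G (tnth (species_vector P) i)).

(** Neighbours of [Phi s] in P' are indexed by cells of P relative to s. Those within the cutoff in
    P' are within cutoff + 2d <= cutoff + 1 in P, hence in a window independent of P' and of the
    matching. *)
Lemma featuresS_window P P' (Phi Psi : index -> index) (d : R) (N : nat) t s :
  matching d P P' Phi Psi -> d + d <= 1 ->
  (forall i (jk : index), `|site P jk.1 jk.2 - site P i 0| <= cutoff G + 1 ->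
    forall a, (`|jk.2 a ord0| <= N)%N) ->
  features P' t.+1 (Phi s).1 = features P' t (Phi s).1 +
    \sum_(jk <- window n N) edge_term (features P' t (Phi s).1)
       (features P' t (Phi (jk.1, (s.2 + jk.2)%R)).1)
       (site P' (Phi (jk.1, (s.2 + jk.2)%R)).1 (Phi (jk.1, (s.2 + jk.2)%R)).2
        - site P' (Phi s).1 (Phi s).2).
Proof.
move=> [PhiK PsiK _ PhiD] d1 PN.
rewrite [LHS]updateE; congr (_ + _).
(* [h] and [h'] are Phi and Psi with cells taken relative to s and [Phi s]. *)
pose h (jk : index) : index :=
  ((Phi (jk.1, s.2 + jk.2)).1, (Phi (jk.1, s.2 + jk.2)).2 - (Phi s).2).
pose h' (jk : index) : index :=
  ((Psi (jk.1, (Phi s).2 + jk.2)).1, (Psi (jk.1, (Phi s).2 + jk.2)).2 - s.2).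
rewrite (@reindex_fsbigT _ _ _ _ _ h); last first.
  exists h' => -[j k]; rewrite /h /h' /= subrKC -surjective_pairing.
    by rewrite PhiK/= addrAC subrr add0r.
  by rewrite PsiK/= addrAC subrr add0r.
rewrite [RHS](@fsbig_seq _ _ _ _ (window n N))//.
rewrite (@fsbig_widen _ _ _ _ [set` window n N] setT)//.
  apply: eq_fsbigr => jk _; rewrite /h [(_, _).1]/= [(_, _).2]/=; congr edge_term.
  by rewrite siteB -addrA -opprD [_ + col _ _]addrC.
move=> jk [_ /= jkN]; apply: edge_term_eq0.
rewrite leNgt; apply/negP => jkG; apply: jkN; apply/mem_window; apply: (PN s.1).
rewrite -(siteB_shift P _ _ _ s.2).
have := PhiD (jk.1, s.2 + jk.2); have := PhiD s => /=.
move: jkG => /(le_lt_trans (mx_norm_le_enorm _)).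
set q := Phi (_, _); move: (site P' q.1 q.2) (site P' (Phi s).1 (Phi s).2).
move: (site P _ _) (site P _ _) => x y x' y' xy' y'd x'd.
have -> : x - y = (x' - y') - ((x' - x) - (y' - y)).
  by apply/matrixP => ? ?; rewrite !mxE; ring.
rewrite (le_trans (ler_normB _ _))// lerD//; first exact: ltW.
by rewrite (le_trans (ler_normB _ _))// (le_trans _ d1)// ltW// ltrD.
Qed.

(** Induction on t: an update adds finitely many terms, continuous in features and relative
    positions. By periodicity of P, continuity is required at finitely many points only, one for
    each type and window cell, so d is uniform in s and in the matching. *)
Lemma features_near P t (e : R) : lattice P \in unitmx -> 0 < e ->
  \forall d \near 0^'+, forall P' Phi Psi, matching d P P' Phi Psi ->
    forall s, `|features P' t (Phi s).1 - features P t s.1| < e.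
Proof.
move=> Lu; elim: t e => [|t IHt] e e0.
  near=> d => P' Phi Psi [_ _ Phi_species _] s.
  by rewrite /features/= Phi_species subrr normr0.
have [N0 PN0] := site_near (cutoff G + 1) Lu.
have PN i (jk : index) : `|site P jk.1 jk.2 - site P i 0| <= cutoff G + 1 ->
    forall a, (`|jk.2 a ord0| <= N0)%N.
  by move=> /PN0 + a => /(_ a); rewrite mxE subr0.
pose W := window n N0.
(* Half of e is for the old feature, half for the window sum; the successor keeps the divisor
   positive and the last inequality strict. *)
pose e' := e / 2 / (#|` W|.+1)%:R.
have e'0 : 0 < e' by rewrite !divr_gt0.
pose p i (jk : index) : V * V * 'cV[R]_3 :=
  (features P t i, features P t jk.1, site P jk.1 jk.2 - site P i 0).
pose f (q : V * V * 'cV[R]_3) := edge_term q.1.1 q.1.2 q.2.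
have : \forall h \near 0^'+, forall x, x \in (enum 'I_n) -> forall jk, jk \in W ->
    forall q, `|q - p x jk| < h -> `|f q - f (p x jk)| < e'.
  apply: near_seq => i _; apply: near_seq => jk _.
  exact: (continuous_at_right0 (@edge_term_continuous _ _ G (p i jk)) e'0).
move=> /(filterI (nbhs_right_gt 0))/filter_ex[h [h0 hf]].
have e20 : 0 < e / 2 by rewrite divr_gt0.
near=> d.
have IHh : forall P' Phi Psi, matching d P P' Phi Psi ->
    forall s, `|features P' t (Phi s).1 - features P t s.1| < h.
  by near: d; exact: IHt.
have IHe : forall P' Phi Psi, matching d P P' Phi Psi ->
    forall s, `|features P' t (Phi s).1 - features P t s.1| < e / 2.
  by near: d; exact: IHt.
have d1 : d + d <= 1.
  have : d < 1 / 2 by near: d; apply: nbhs_right_lt; rewrite divr_gt0.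
  by lra.
have dh : d + d <= h.
  have : d < h / 2 by near: d; apply: nbhs_right_lt; rewrite divr_gt0.
  by lra.
have d0 : 0 < d by near: d; exact: nbhs_right_gt.
move=> P' Phi Psi m s.
(* The identity matching expands the features of P itself over the same window. *)
have m0 : matching d P P id id.
  by split => // r; rewrite subrr normr0.
rewrite (featuresS_window _ _ m d1 PN) (featuresS_window _ _ m0 _ PN)//=.
rewrite [- (features P t s.1 + _)]opprD addrACA -sumrB.
rewrite (le_lt_trans (ler_normD _ _))// (splitr e) ltrD//.
  exact: (IHe _ _ _ m).
rewrite (le_lt_trans (ler_norm_sum _ _ _))//.
apply: (@le_lt_trans _ _ (\sum_(jk <- W) e')).
  rewrite big_seq_cond [leRHS]big_seq_cond; apply: ler_sum => jk /andP[jkW _].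
  apply/ltW; set x := (X in edge_term _ _ X - _).
  have := hf s.1 (mem_enum _ _) jk jkW
    (features P' t (Phi s).1, features P' t (Phi (jk.1, s.2 + jk.2)).1, x).
  rewrite /f /p /= -(siteB_shift P _ _ _ s.2); apply.
  rewrite prod_normE/= gt_max prod_normE/= gt_max.
  apply/andP; split; first by apply/andP; split; exact: (IHh _ _ _ m).
  rewrite (lt_le_trans _ dh)//.
  have := matching_dist m (jk.1, s.2 + jk.2); have := matching_dist m s => /=.
  rewrite /x; set q := Phi (_, _).
  move: (site P' q.1 q.2) (site P' (Phi s).1 (Phi s).2).
  move: (site P _ _) (site P _ _) => y z y' z' zd yd.
  have -> : y' - z' - (y - z) = (y' - y) - (z' - z).
    by apply/matrixP => ? ?; rewrite !mxE; ring.
  by rewrite (le_lt_trans (ler_normB _ _))// ltrD.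
rewrite big_const_seq count_predT iter_addr addr0 -[e' *+ _]mulr_natr.
rewrite /e' -mulrA gtr_pMr// mulrC.
by rewrite ltr_pdivrMr// mul1r ltr_nat.
Unshelve. all: by end_near. Qed.

(** [features_near] compares matched atoms, [matching_sum] carries the bound over to the means, and
    continuity of [readout] concludes. *)
Lemma energy_near P (e : R) : periodic_unit P -> 0 < e ->
  exists2 d : R, 0 < d & forall P', periodic_unit P' ->
    close_materials d (PtoS P) (PtoS P') -> `|energy G P' - energy G P| < e.
Proof.
move=> uP e0.
pose mean P := n%:R^-1 *: \sum_i features P (num_updates G) i.
have [h [h0 hG]] := filter_ex (filterI (nbhs_right_gt (0 : R))
  (continuous_at_right0 (@readout_continuous _ _ G (mean P)) e0)).
have h20 : 0 < h / 2 by rewrite divr_gt0.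
have [d [d0 dP]] := filter_ex (filterI (nbhs_right_gt (0 : R))
  (features_near (num_updates G) (proj1 uP) h20)).
exists d => // P' uP' /(close_matching uP uP')[Phi [Psi m]].
apply: hG; rewrite -scalerBr normrZ ger0_norm ?invr_ge0//.
apply: (@le_lt_trans _ _ (h / 2)); last by lra.
(* For n = 0 the inverse is 0 by convention. *)
have mean_le (S : R) : S <= n%:R * (h / 2) -> n%:R^-1 * S <= h / 2.
  have [->|n0] := posnP n; first by rewrite mulr0n invr0 !mul0r (ltW h20).
  by rewrite ler_pdivrMl ?ltr0n.
apply: mean_le; apply: (matching_sum (proj1 uP) m (ltW h20)) => s.
by apply/ltW; apply: dP m s.
Qed.
End features.

(** * Divergence of the partition function *)

Section divergence.
Variables (R : realType) (species : finType) (G : cgcnn R species) (n : nat).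
Local Notation RM := (measurableTypeR R).
Implicit Types P : description R species n.

Lemma measurable_box d (a b : 'I_d -> R) :
  measurable [set t : d.-tuple RM | forall i, a i <= tnth t i <= b i].
Proof.
rewrite (_ : mkset _ = \bigcap_(i in [set: 'I_d])
    ((fun t : d.-tuple RM => tnth t i) @^-1` `[a i, b i])).
  apply: fin_bigcap_measurable => // i _.
  by rewrite -[X in measurable X]setTI; exact: measurable_tnth.
apply/seteqP; split => t /= Ht i; last by have := Ht i I; rewrite /= in_itv.
by move=> _; rewrite /= in_itv; exact: Ht.
Qed.

Lemma lebesgue_tuple_setX p q (X : set (p.-tuple RM)) (Y : set (q.-tuple RM)) :
  measurable X -> measurable Y ->
  ((lebesgue_tuple R p \x lebesgue_tuple R q) (X `*` Y) =
   lebesgue_tuple R p X * lebesgue_tuple R q Y)%E.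
Proof. exact: product_measure1E. Qed.

(* No measurability of [f] or [D] is assumed: the integral of a nonnegative
   function is a supremum over the simple functions below it. *)
Lemma integral_ge_cst d (T : measurableType d) (mu : {measure set T -> \bar R})
    (D B : set T) (f : T -> \bar R) (c : R) :
  measurable B -> B `<=` D -> 0 <= c -> (forall x, 0 <= f x)%E ->
  (forall x, B x -> c%:E <= f x)%E -> (c%:E * mu B <= \int[mu]_(x in D) f x)%E.
Proof.
move=> mB BD c0 f0 cf; rewrite integral_mkcond ge0_integralTE; last first.
  by move=> x; rewrite patchE; case: ifP.
apply: ereal_sup_ubound => /=.
exists (scale_nnsfun (indic_nnsfun R mB) c0) => /=.
  move=> x; rewrite -[X in (X%:E <= _)%E]/(c * (x \in B)%:R) patchE.
  case: (boolP (x \in B)) => xB.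
    by rewrite mem_set ?mulr1; [apply: cf; rewrite -inE|apply: BD; rewrite -inE].
  by rewrite mulr0; case: ifP.
by rewrite -(sintegral_indic mu B) -(sintegralrM mu c (indic_nnsfun R mB)).
Qed.

(** In a row where x attains its max norm, the two off-diagonal terms cost at most that norm
    each. *)
Lemma diag_dominant_norm (L : 'M[R]_3) (c : R) (x : 'cV[R]_3) :
  (forall a, c <= L a a) -> (forall a b, a != b -> 0 <= L a b <= 1) ->
  (c - 2) * `|x| <= `|L *m x|.
Proof.
move=> Ldiag Loff.
have [x0|x0] := eqVneq `|x| 0; first by rewrite x0 mulr0.
have [[a b] /= xa] := mx_norm_neq0 x0.
have {b}xa : `|x| = `|x a 0| by rewrite [LHS]xa (ord1 b).
rewrite (le_trans _ (entry_le_mx_norm _ a 0))//.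
rewrite mxE (bigD1 a)//= (le_trans _ (lerB_normD _ _))//.
rewrite mulrBl lerB//.
  by rewrite xa normrM ler_wpM2r// (le_trans (Ldiag a))// ler_norm.
have -> : 2 * `|x| = \sum_(b | b != a) `|x|.
  by rewrite sumr_const cardC1 card_ord mulr_natl.
rewrite (le_trans (ler_norm_sum _ _ _))// ler_sum// => b ab.
have /andP[L0 L1] : 0 <= L a b <= 1 by rewrite Loff// eq_sym.
by rewrite normrM ger0_norm// (le_trans _ (entry_le_mx_norm x b 0))// ler_piMl.
Qed.

(** The columns of the cokernel matrix are killed by L, hence zero, so L has full rank. *)
Lemma unitmx_inj (L : 'M[R]_3) :
  (forall x : 'cV[R]_3, L *m x = 0 -> x = 0) -> L \in unitmx.
Proof.
move=> Linj; rewrite -row_full_unit /row_full.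
have := mxrank_coker L; suff -> : cokermx L = 0.
  by rewrite mxrank0 => /esym/eqP; rewrite subn_eq0 eqn_leq rank_leq_col => ->.
apply/matrixP => i j.
have /colP/(_ i) : col j (cokermx L) = 0.
  by apply: Linj; rewrite colE mulmxA mulmx_coker mul0mx.
by rewrite !mxE.
Qed.

(** The pair (i, 0) is excluded because every atom is its own neighbour. *)
Definition isolated P := forall i j k, (j, k) <> (i, 0) ->
  cutoff G <= `|site P j k - col i (coordinates P)|.

(** Each update involves only the term of an atom with itself, so features depend on the species
    alone. *)
Lemma energy_isolated P P' : species_vector P = species_vector P' ->
  isolated P -> isolated P' -> energy G P = energy G P'.
Proof.
move=> PP' iP iP'.
have step Q (v : 'I_n -> 'rV[R]_(node_dim G)) i : isolated Q ->
    update Q v i = v i + edge_term (v i) (v i) 0.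
  move=> iQ; rewrite updateE -(@fsbig_widen _ _ _ _ [set (i, 0)] setT)//=.
    by rewrite fsbig_set1/= site0 subrr.
  move=> [j k] [_ /= jk]; apply: edge_term_eq0.
  by rewrite (le_trans (iQ i j k jk))// mx_norm_le_enorm.
rewrite /energy /node_features -PP'; congr (readout (_ *: _)).
apply: eq_bigr => i _; elim: (num_updates G) i => [//|t IHt] i.
by rewrite !iterS (step P _ _ iP) (step P' _ _ iP') IHt.
Qed.

Lemma isolated_periodic_unit P : lattice P \in unitmx -> isolated P -> periodic_unit P.
Proof.
move=> Pu iP; split => // i j k ijk jk.
suff : cutoff G <= 0 by rewrite leNgt cutoff_gt0.
rewrite -(normr0 'cV[R]_3) -(subrr (site P j k)) [X in _ - X]jk; apply: iP.
by case=> ji k0; case: ijk; [rewrite ji|rewrite k0].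
Qed.

Lemma tuple_mxE m p (t : (m * p).-tuple RM) i j :
  tuple_mx t i j = tnth t (mxvec_index i j).
Proof. by rewrite !mxE. Qed.

(** Spacing 2D with slack D leaves gaps of at least D inside a cell, whose coordinates lie in
    [0, 2Dn]. Nonzero lattice vectors have norm at least 2Dn + D, so distinct cells are D apart; the
    extra 2 on the diagonal is the loss in [diag_dominant_norm]. *)
Lemma spread_isolated P :
  (forall r (i : 'I_n), 2 * cutoff G * i%:R <= coordinates P r i <=
    2 * cutoff G * i%:R + cutoff G) ->
  (forall a, 2 + 2 * cutoff G * n%:R + cutoff G <= lattice P a a) ->
  (forall a b, a != b -> 0 <= lattice P a b <= 1) ->
  periodic_unit P /\ isolated P.
Proof.
set D := cutoff G; have D0 : 0 < D := cutoff_gt0 G.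
move=> PX Pdiag Poff.
have Lnorm (x : 'cV[R]_3) : (2 * D * n%:R + D) * `|x| <= `|lattice P *m x|.
  apply: le_trans (diag_dominant_norm _ Pdiag Poff).
  by rewrite ler_wpM2r//; lra.
have Dn0 : 0 <= 2 * D * n%:R by rewrite !mulr_ge0// ltW.
suff iP : isolated P.
  split => //; apply: isolated_periodic_unit => //; apply: unitmx_inj => x Lx0.
  have := Lnorm x; rewrite Lx0 normr0 pmulr_rle0; last by lra.
  by rewrite normr_le0 => /eqP.
move=> i j k jk; rewrite -/D.
have [k0|k0] := eqVneq k 0.
  have ij : j != i by apply: contra_not_neq jk => ->; rewrite k0.
  apply: le_trans (entry_le_mx_norm _ 0 0).
  rewrite k0 site0 !mxE.
  have /andP[] := PX 0 i; have /andP[] := PX 0 j.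
  have [lt_ij|lt_ji|/val_inj ji] := ltngtP i j; last by rewrite ji eqxx in ij.
    have : D * i.+1%:R <= D * j%:R by rewrite ler_pM2l// ler_nat.
    by rewrite -natr1 mulrDr mulr1 ler_normr => ? ? ? ? ?; apply/orP; left; lra.
  have : D * j.+1%:R <= D * i%:R by rewrite ler_pM2l// ler_nat.
  by rewrite -natr1 mulrDr mulr1 ler_normr => ? ? ? ? ?; apply/orP; right; lra.
have k1 : 1 <= `|map_mx intr k : 'cV[R]_3|.
  have /existsP[a ka] : [exists a, k a 0 != 0].
    rewrite -negb_forall; apply: contra k0 => /forallP k0.
    by apply/eqP/colP => a; rewrite mxE; apply/eqP.
  apply: le_trans (entry_le_mx_norm _ a 0).
  by rewrite mxE -intr_norm ler1z; move: (k a 0) ka => m; lia.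
have xij : `|col i (coordinates P) - col j (coordinates P)| <= 2 * D * n%:R.
  apply: mx_norm_le => // r c; rewrite !mxE.
  have coord m : 0 <= coordinates P r m <= 2 * D * n%:R.
    have /andP[lo hi] := PX r m; apply/andP; split.
      by rewrite (le_trans _ lo)// !mulr_ge0// ltW.
    rewrite (le_trans hi)//.
    have : D * m.+1%:R <= D * n%:R by rewrite ler_pM2l// ler_nat.
    by rewrite -natr1 mulrDr mulr1; lra.
  have /andP[? ?] := coord i; have /andP[? ?] := coord j.
  by rewrite ler_norml; apply/andP; split; lra.
rewrite /site addrAC addrC -opprB (le_trans _ (lerB_dist _ _))//.
have := le_trans _ (Lnorm (map_mx intr k)) => /(_ (2 * D * n%:R + D)).
rewrite ler_peMr// => [/(_ erefl)|]; last by lra.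
by move: xij; lra.
Qed.

Lemma partition_function_infty (beta : R) (A : n.-tuple species) :
  partition_function G beta A = +oo%E.
Proof.
set D := cutoff G; have D0 : 0 < D := cutoff_gt0 G.
pose X0 : 'M[R]_(3, n) := \matrix_(r < 3, i < n) (2 * D * i%:R).
pose L0 : 'M[R]_3 := (2 + 2 * D * n%:R + D)%:M.
pose k0 := mxvec_index (0 : 'I_3) (0 : 'I_3).
(* One diagonal entry of L ranges over an interval of arbitrary length M. *)
pose side M : 'rV[R]_(3 * 3) :=
  mxvec (\matrix_(a, b) if (a == 0) && (b == 0) then M else 1).
have sideE M a b : side M 0 (mxvec_index a b) = if (a == 0) && (b == 0) then M else 1.
  by rewrite mxvecE mxE.
pose boxX := [set t : (3 * n).-tuple RM |
  forall k, mxvec X0 0 k <= tnth t k <= mxvec X0 0 k + D].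
pose boxL M := [set t : (3 * 3).-tuple RM |
  forall k, mxvec L0 0 k <= tnth t k <= mxvec L0 0 k + side M 0 k].
pose P (z : (3 * n).-tuple RM * (3 * 3).-tuple RM) :=
  Description A (tuple_mx z.1) (tuple_mx z.2).
have boxP M z : (boxX `*` boxL M) z -> periodic_unit (P z) /\ isolated (P z).
  move=> [zX zL]; apply: spread_isolated => [r i|a|a b ab] /=.
  - by have := zX (mxvec_index r i); rewrite tuple_mxE mxvecE mxE.
  - by have /andP[+ _] := zL (mxvec_index a a); rewrite tuple_mxE mxvecE mxE eqxx.
  - have := zL (mxvec_index a b); rewrite tuple_mxE mxvecE mxE (negbTE ab) add0r.
    by rewrite sideE; case: ifP ab => // /andP[/eqP -> /eqP ->]; rewrite eqxx.
pose P0 := Description A X0 L0.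
have iP0 : isolated P0.
  suff [] : periodic_unit P0 /\ isolated P0 by [].
  apply: spread_isolated => [r i|a|a b ab] /=; rewrite !mxE ?eqxx//.
    by rewrite lexx lerDl ltW.
  by rewrite (negbTE ab) mulr0n lexx ler01.
set c := expR (- beta * energy G P0).
have c0 : 0 < c by exact: expR_gt0.
have bound M : 1 <= M -> ((c * (D ^+ (3 * n) * M))%:E <= partition_function G beta A)%E.
  move=> M1.
  have volX : lebesgue_tuple R (3 * n) boxX = (D ^+ (3 * n))%:E.
    rewrite lebesgue_tuple_box => [|k]; last by rewrite lerDl ltW.
    by under eq_bigr do rewrite addrAC subrr add0r; rewrite prodr_const card_ord.
  have volL : lebesgue_tuple R (3 * 3) (boxL M) = M%:E.
    rewrite lebesgue_tuple_box => [|k]; last first.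
      rewrite lerDl; case/mxvec_indexP: k => a b.
      by rewrite sideE; case: ifP => _ //; lra.
    under eq_bigr do rewrite addrAC subrr add0r.
    rewrite (bigD1 k0)//= sideE/= big1 ?mulr1// => k.
    case/mxvec_indexP: k => a b; rewrite sideE; case: ifP => // /andP[/eqP -> /eqP ->].
    by rewrite eqxx.
  have -> : ((c * (D ^+ (3 * n) * M))%:E = c%:E *
     (lebesgue_tuple R (3 * n) \x lebesgue_tuple R (3 * 3)) (boxX `*` boxL M))%E.
    by rewrite lebesgue_tuple_setX ?volX ?volL; [|exact: measurable_box..].
  apply: integral_ge_cst => [|z /boxP[]//||z|z /boxP[_ iPz]].
  - by apply: measurableX; exact: measurable_box.
  - exact: ltW.
  - by rewrite lee_fin expR_ge0.
  - have eP : energy G P0 = energy G (P z)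
      by exact: (@energy_isolated P0 (P z) erefl iP0 iPz).
    by rewrite /c eP; exact: lexx.
apply/eqyP => x x0.
(* The quotient makes the lower bound reach x; the maximum with 1 meets the condition of [bound]. *)
pose M := Num.max 1 (x / (c * D ^+ (3 * n))).
rewrite (le_trans _ (bound M _))//; last by rewrite /M le_max lexx.
rewrite lee_fin mulrA -ler_pdivrMl ?mulr_gt0 ?exprn_gt0// mulrC.
by rewrite /M le_max lexx orbT.
Qed.

End divergence.

(** * Isometries *)

Section moved_descriptions.
Variables (R : realType) (species : finType) (G : cgcnn R species) (n : nat).
Variables (P P' : description R species n) (h : 'cV[R]_3 -> 'cV[R]_3).
Hypothesis eq_species : species_vector P' = species_vector P.
Hypothesis move_site : forall j k, site P' j k = h (site P j k).

Lemma PtoS_move : PtoS P' = map_material h (PtoS P).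
Proof.
apply: material_eq; apply/seteqP; split=> [_ [s _ <-]|_ [_ [s _ <-] <-]] /=.
  exists (tnth (species_vector P) s.1, site P s.1 s.2); first by exists s.
  by rewrite /map_position/= eq_species move_site.
by exists s => //; rewrite /map_position/= eq_species move_site.
Qed.

Lemma periodic_unit_move : injective h -> lattice P' \in unitmx ->
  periodic_unit P -> periodic_unit P'.
Proof.
move=> h_inj P'u [_ Pdisj]; split => // i j k ijk.
by rewrite -site0 !move_site => /h_inj; rewrite site0; exact: Pdisj.
Qed.

(** Positions enter the energy through edge lengths only, which an isometry preserves. *)
Lemma energy_move : (forall x y, enorm (h x - h y) = enorm (x - y)) ->
  energy G P' = energy G P.
Proof.
move=> h_isom.
have length i jk : edge_length P' i jk = edge_length P i jk.
  by rewrite /edge_length -!site0 !move_site h_isom.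
have upd : @update _ _ G _ P' = update P.
  apply/funext => v; apply/funext => i; rewrite /update.
  have -> : neighbours G P' i = neighbours G P i.
    by apply/funext => jk; rewrite /neighbours /mkset length.
  by congr (_ + _); apply: eq_fsbigr => jk _; rewrite length.
by rewrite /energy /node_features upd eq_species.
Qed.

End moved_descriptions.

Theorem theorem4 (R : realType) (species : finType) (G : cgcnn R species)
    (beta : R) (beta_gt0 : 0 < beta)
    (to_real : \bar R -> R) (to_realE : forall r : R, to_real r%:E = r)
    (n : nat) (n_gt0 : (0 < n)%N) :
  weakly_redescription_invariant n (conditional_density G to_real beta) /\
  [/\ translation_invariant (induced_map n (conditional_density G to_real beta)),
      rotation_invariant (induced_map n (conditional_density G to_real beta)) &
      material_continuous (Y := R^o) (induced_map n (conditional_density G to_real beta))].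
Proof.
set g := conditional_density G to_real beta.
(* The divisor is a constant, so this is continuous in E; if it is 0, the quotient is 0 by
   convention. *)
pose weight (E : R) : R^o := expR (- beta * E) / to_real +oo%E.
have gE (P : description R species n) : g n P = weight (energy G P).
  by rewrite /g /conditional_density partition_function_infty.
have weight_continuous : continuous weight.
  move=> E; apply: cvgM; last exact: cvg_cst.
  apply: continuous_cvg; first exact: continuous_expR.
  by apply: cvgM; [exact: cvg_cst|exact: cvg_id].
have redescr : weakly_redescription_invariant n g.
  move=> P P' uP uP' PP'; rewrite !gE; congr weight.
  apply/eqP; rewrite -subr_eq0 -normr_le0; apply/ler_addgt0Pl => e e0; rewrite addr0.
  have [d d0 dP] := energy_near G uP e0.
  apply/ltW/dP => //; rewrite PP'; exists id.
    by split=> [s|s t|s Ss] //; exists s.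
  by move=> s _; rewrite subrr enorm0.
(* One argument for both invariances: an isometry is injective, so P' is again a periodic unit, with
   the same energy. *)
have induced_move (P P' : description R species n) h : periodic_unit P ->
    species_vector P' = species_vector P ->
    (forall j k, site P' j k = h (site P j k)) ->
    lattice P' \in unitmx -> (forall x y, enorm (h x - h y) = enorm (x - y)) ->
    induced_map n g (map_material h (PtoS P)) = induced_map n g (PtoS P).
  move=> uP eq_species move_site P'u h_isom.
  have h_inj : injective h.
    move=> x y hxy; apply/eqP; rewrite -subr_eq0 -normr_le0.
    by rewrite (le_trans (mx_norm_le_enorm _))// -h_isom hxy subrr enorm0.
  have uP' := periodic_unit_move move_site h_inj P'u uP.
  rewrite -(PtoS_move eq_species move_site) (induced_mapE redescr uP').
  rewrite (induced_mapE redescr uP) !gE.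
  by rewrite (energy_move G eq_species move_site h_isom).
split => //; split.
- move=> S; rewrite Dom_induced_map => -[P uP <-] b.
  pose P' := Description (species_vector P)
    (coordinates P + \matrix_(r, j) b r 0) (lattice P).
  apply: (@induced_move P P') => //; last 2 first.
  - exact: (proj1 uP).
  - by move=> x y; congr enorm; rewrite opprD addrACA subrr addr0.
  move=> j k; rewrite /site /= addrAC; congr (_ + _).
  by apply/colP => r; rewrite !mxE.
- move=> S; rewrite Dom_induced_map => -[P uP <-] Q QQ.
  (* The basis is rotated along with the coordinates, so that Q acts on every site. *)
  pose P' := Description (species_vector P) (Q *m coordinates P) (Q *m lattice P).
  apply: (@induced_move P P') => //=.
  - by move=> j k; rewrite /site /= mulmxDr !colE !mulmxA.
  - by rewrite unitmx_mul (proj1 uP) andbT; case: (mulmx1_unit QQ).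
  - by move=> x y; rewrite -mulmxBr enorm_orthogonal.
move=> S; rewrite Dom_induced_map => -[P uP <-] y.
rewrite (induced_mapE redescr uP) => -[<-] e e0.
have [h [h0 hw]] := filter_ex (filterI (nbhs_right_gt (0 : R))
  (continuous_at_right0 (weight_continuous (energy G P)) e0)).
have [d d0 dP] := energy_near G uP h0.
exists d => // S' y' S'y'.
have : Dom (induced_map n g) S' by exists y'.
rewrite Dom_induced_map => -[P' uP' PS'].
rewrite -PS' (induced_mapE redescr uP') in S'y' *.
case: S'y' => <- /(dP _ uP') /hw; rewrite !gE; exact.
Qed.
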